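(* Let $p\ge1$, let $W$ be a Banach space and $a<b$ real numbers. Suppose that $\phi:[0,+\infty)\to[0,+\infty)$ is such that $\phi(0)=0$ and, for each $t>0$, $\phi(t)>0$ and $$\sup_{0<u\le s\le2u\le2t}\frac{\phi(s)}{\phi(u)}<+\infty,$$ and moreover $$\sum_{j=0}^{+\infty}2^{pj}\phi(2^{-j})<+\infty.$$ Then for any function $f\in\mathcal{U}^{p}([a,b],W)$ one has $V^{\phi}(f,[a,b])<+\infty$.
   Context: For $f:[a,b]\to W$ and $\delta\ge0$, the truncated variation is $$\mathrm{TV}^{\delta}(f,[a,b]):=\sup_{n}\ \sup_{a\le t_{0}<t_{1}<\ldots<t_{n}\le b}\ \sum_{i=1}^{n}\max\{\|f(t_{i})-f(t_{i-1})\|_W-\delta,0\},$$ and $\mathcal{U}^{p}([a,b],W)$ is the set of functions $f:[a,b]\to W$ with $\sup_{\delta>0}\delta^{p-1}\mathrm{TV}^{\delta}(f,[a,b])<+\infty$. For a function $\phi:[0,+\infty)\to[0,+\infty)$ the $\phi$-variation of $f$ is $$V^{\phi}(f,[a,b]):=\sup_{n}\ \sup_{a\le t_{0}<t_{1}<\ldots<t_{n}\le b}\ \sum_{i=1}^{n}\phi\left(\|f(t_{i})-f(t_{i-1})\|_{W}\right).$$ *)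

(* Defs.v *)
From HB Require Import structures.
From mathcomp Require Import all_boot all_order all_algebra.
From mathcomp Require Import all_classical all_reals all_analysis.

Set Implicit Arguments.
Unset Strict Implicit.
Unset Printing Implicit Defensive.

Import Order.TTheory GRing.Theory Num.Theory.
Import numFieldNormedType.Exports.

Local Open Scope classical_set_scope.
Local Open Scope ring_scope.

(* A function [a, b] -> W is represented by a total function f : R -> W; the
   definitions below only evaluate f at points of [a, b]. *)

(* Only the values t 0, ..., t n matter. The case n = 0 yields empty sums, which
   do not affect the suprema below when a < b. *)
Definition grid (R : realType) (a b : R) (n : nat) : set (nat -> R) :=
  [set t | [/\ a <= t 0%N,
               forall i, (i < n)%N -> t i < t i.+1
             & t n <= b]].

Definition truncated_variation (R : realType) (W : normedModType R)
    (delta : R) (f : R -> W) (a b : R) : \bar R :=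
  ereal_sup (range (fun n : nat =>
    ereal_sup [set (\sum_(i < n)
                      Num.max (`|f (t i.+1) - f (t i)| - delta) 0)%:E
              | t in grid a b n])).

Definition U_class (R : realType) (W : normedModType R)
    (p a b : R) : set (R -> W) :=
  [set f | (ereal_sup [set (delta `^ (p - 1))%:E *
                            truncated_variation delta f a b
                      | delta in [set delta : R | (0 < delta)%R]] < +oo)%E].

Definition phi_variation (R : realType) (W : normedModType R)
    (phi : R -> R) (f : R -> W) (a b : R) : \bar R :=
  ereal_sup (range (fun n : nat =>
    ereal_sup [set (\sum_(i < n) phi `|f (t i.+1) - f (t i)|)%:E
              | t in grid a b n])).

(* Main.v *)
(** A jump of size [x], with [2^-k <= x <= 2^(1-k)], exceeds the threshold
    [2^-(k+1)] by at least [2^-(k+1)], so that by the doubling condition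
    [phi x <= D * phi (2^-k) * 2^(k+1) * max (x - 2^-(k+1)) 0]; jumps larger
    than 1 are bounded, hence controlled by the excess over [1/2].  Summing over
    the jumps, each dyadic scale contributes at most a constant times
    [2^(p k) * phi (2^-k)], because [TV^delta <= C * delta^(1-p)]. *)
Require Import Defs.
From HB Require Import structures.
From mathcomp Require Import all_boot all_order all_algebra.
From mathcomp Require Import all_classical all_reals all_analysis.
From mathcomp Require Import ring lra.

Set Implicit Arguments.
Unset Strict Implicit.

Import Order.TTheory GRing.Theory Num.Theory.
Import numFieldNormedType.Exports.

Local Open Scope classical_set_scope.
Local Open Scope ring_scope.

Lemma ereal_sup_lt_pinfty_bound (R : realType) (A : set (\bar R)) :
  (ereal_sup A < +oo)%E ->
  exists2 C : R, 0 <= C & forall x, A x -> (x <= C%:E)%E.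
Proof.
move=> supA; exists (Num.max 0 (fine (ereal_sup A))); first by rewrite le_max lexx.
move=> x Ax; apply: (le_trans (ereal_sup_ubound Ax)).
move: supA; case: (ereal_sup A) => [r _| //|_] /=; last by rewrite leNye.
by rewrite lee_fin le_max lexx orbT.
Qed.

Lemma dyadic_scale (R : realFieldType) (m : nat) (x : R) :
  2 ^- m <= x -> x <= 1 ->
  exists2 k, (k <= m)%N & 2 ^- k <= x <= 2 * 2 ^- k.
Proof.
elim: m => [|m IHm] xm x1.
  by exists 0%N => //; move: xm; rewrite expr0 invr1 => xm; apply/andP; split; lra.
have [xm'|xm'] := lerP (2 ^- m) x.
  by have [k km kx] := IHm xm' x1; exists k => //; exact: leqW.
exists m.+1 => //; rewrite xm /= exprS invfM mulrA mulfV // mul1r.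
exact: ltW.
Qed.

Lemma exists_dyadic_scale (R : realType) (x : R) :
  0 < x -> x <= 1 -> exists k, 2 ^- k <= x <= 2 * 2 ^- k.
Proof.
move=> x0 x1.
(* With [N] the integer part of [x^-1], [x^-1 < N + 1 <= 2 ^ N]. *)
have xm : 2 ^- (Num.truncn x^-1) <= x.
  rewrite invf_ple ?posrE ?exprn_gt0 //.
  apply/ltW/(lt_le_trans (truncnS_gt _)).
  by rewrite -natrX ler_nat ltn_expl.
by have [k _ kx] := dyadic_scale xm x1; exists k.
Qed.

Lemma truncation_powR (R : realType) (p S C : R) (k : nat) :
  (2 ^- k.+1) `^ (p - 1) * S <= C ->
  2 ^+ k.+1 * S <= C * 2 `^ p * 2 `^ (p * k%:R).
Proof.
rewrite -powR_inv1 ?exprn_ge0 // -powR_mulrn // -!powRrM => SC.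
have -> : C * 2 `^ p * 2 `^ (p * k%:R) =
    2 `^ k.+1%:R * (2 `^ (k.+1%:R * (p - 1)) * C).
  rewrite mulrA -powRD ?pnatr_eq0 ?implybT // -mulrA -powRD ?pnatr_eq0 ?implybT //.
  by rewrite mulrC; congr (_ `^ _ * _); rewrite -natr1; ring.
rewrite ler_pM2l ?powR_gt0 //.
apply: le_trans (ler_wpM2l (powR_ge0 _ _) SC).
rewrite [leRHS]mulrA -powRD ?pnatr_eq0 ?implybT //.
rewrite (_ : _ + _ = 0) ?powRr0 ?mul1r //; ring.
Qed.

Section DoublingFunction.
Variables (R : realType) (phi : R -> R).
Hypothesis phi_gt0 : forall t : R, 0 < t -> 0 < phi t.
Hypothesis phi_doubling : forall t : R, 0 < t ->
  (ereal_sup [set r : \bar R | exists u s : R,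
     [/\ 0 < u, u <= s, s <= 2 * u, 2 * u <= 2 * t
       & r = (phi s / phi u)%:E]%R] < +oo)%E.

Lemma doubling_bound (t : R) : 0 < t ->
  exists2 D, 0 <= D & forall u s, 0 < u -> u <= s -> s <= 2 * u -> u <= t ->
    phi s <= D * phi u.
Proof.
move=> /phi_doubling/ereal_sup_lt_pinfty_bound[D D0 DP]; exists D => // u s u0 us su ut.
rewrite -ler_pdivrMr ?phi_gt0 // -lee_fin; apply: DP.
by exists u, s; split => //; rewrite ler_pM2l.
Qed.

(** Since [phi] need not be monotone, large arguments are halved repeatedly until they reach
    [[1, 2]], each halving costing one doubling constant. *)
Lemma doubling_bounded (K : nat) :
  exists B, forall x, 1 <= x -> x <= 2 ^+ K -> phi x <= B.
Proof.
elim: K => [|K [B BP]].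
  by exists (phi 1) => x x1; rewrite expr0 => x1'; rewrite (le_anti (_ : 1 <= x <= 1)) ?x1.
have [|D D0 DP] := @doubling_bound (2 ^+ K); first exact: exprn_gt0.
have K1 : 1 <= 2 ^+ K :> R by rewrite exprn_ege1 // ler1n.
exists (D * B) => x x1; rewrite exprS => xK.
have [x2|x2] := lerP x 2.
  apply: (@le_trans _ _ (D * phi 1)); first by apply: DP => //; lra.
  by apply: ler_wpM2l => //; exact: BP.
apply: (@le_trans _ _ (D * phi (x / 2))); first by apply: DP; lra.
by apply: ler_wpM2l => //; apply: BP; lra.
Qed.

Lemma doubling_le_truncations (M : R) :
  exists D B, [/\ 0 <= D, 0 <= B & forall x, 0 < x -> x <= M ->
    exists k, phi x <= B * Num.max (x - 2 ^- 1) 0 +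
      D * (phi (2 ^- k) * (2 ^+ k.+1 * Num.max (x - 2 ^- k.+1) 0))].
Proof.
have [D D0 DP] := doubling_bound ltr01.
have [B BP] := doubling_bounded (Num.truncn M).+1.
have B0 : 0 <= B.
  apply: (le_trans (ltW (phi_gt0 ltr01))); apply: BP => //.
  by rewrite exprn_ege1 // ler1n.
(* The factor 2 makes up for the excess over [2 ^- 1] being only known to be at least 1/2 when
   [x > 1]. *)
exists D, (2 * B); split; rewrite ?mulr_ge0 // => x x0 xM.
have max0 (y : R) : 0 <= Num.max y 0 by rewrite le_max lexx orbT.
have phi2 k : 0 < phi (2 ^- k) by rewrite phi_gt0 // invr_gt0 exprn_gt0.
have [x1|x1] := lerP x 1; last first.
  (* For [x > 1] the first term suffices; the scale is arbitrary because its term is nonnegative. *)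
  exists 0%N; apply: ler_wpDr.
    by rewrite mulr_ge0 // mulr_ge0 ?(ltW (phi2 _)) // mulr_ge0 // exprn_ge0.
  have xB : phi x <= B.
    apply: BP; first exact: ltW.
    apply: (le_trans xM); apply/ltW/(lt_le_trans (truncnS_gt _)).
    by rewrite -natrX ler_nat ltnW // ltn_expl.
  apply: (le_trans xB); rewrite mulrAC ler_peMl // expr1.
  have : x - 2^-1 <= Num.max (x - 2^-1) 0 by rewrite le_max lexx.
  lra.
have [k /andP[kx xk]] := exists_dyadic_scale x0 x1; exists k.
apply: ler_wpDl; first by rewrite mulr_ge0 // mulr_ge0.
have k0 : 0 < 2 ^- k :> R by rewrite invr_gt0 exprn_gt0.
apply: (@le_trans _ _ (D * phi (2 ^- k))).
  apply: DP => //; rewrite invf_le1 ?exprn_gt0 //.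
  by rewrite exprn_ege1 // ler1n.
apply: ler_wpM2l => //; rewrite ler_peMr ?(ltW (phi2 _)) //.
rewrite -ler_pdivrMl ?exprn_gt0 // mulr1 le_max; apply/orP; left.
by move: kx; rewrite exprS invfM; lra.
Qed.

End DoublingFunction.

Unset Implicit Arguments.
Set Strict Implicit.

Theorem proposition2 (R : realType) (W : completeNormedModType R)
    (p a b : R) (phi : R -> R)
    (hp : 1 <= p) (hab : a < b)
    (phi_ge0 : forall t : R, 0 <= t -> 0 <= phi t)
    (phi0 : phi 0 = 0)
    (phi_gt0 : forall t : R, 0 < t -> 0 < phi t)
    (phi_doubling : forall t : R, 0 < t ->
      (ereal_sup [set r : \bar R | exists u s : R,
         [/\ 0 < u, u <= s, s <= 2 * u, 2 * u <= 2 * t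
           & r = (phi s / phi u)%:E]%R] < +oo)%E)
    (phi_series :
      (\sum_(0 <= j <oo) (2 `^ (p * j%:R) * phi (2 ^- j))%:E < +oo)%E)
    (f : R -> W) :
  U_class p a b f -> (phi_variation phi f a b < +oo)%E.
Proof.
move=> /ereal_sup_lt_pinfty_bound[C C0 CP].
have trunc_le (delta : R) n t : 0 < delta -> grid a b n t ->
    delta `^ (p - 1) *
      (\sum_(i < n) Num.max (`|f (t i.+1) - f (t i)| - delta) 0) <= C.
  move=> d0 gt; rewrite -lee_fin EFinM.
  apply: (@le_trans _ _
    ((delta `^ (p - 1))%:E * truncated_variation delta f a b)%E); last first.
    by apply: CP; exists delta.
  apply: lee_wpmul2l.
    by rewrite lee_fin powR_ge0.
  apply: ereal_sup_ge; exists (ereal_sup [set (\sum_(i < n)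
    Num.max (`|f (s i.+1) - f (s i)| - delta) 0)%:E | s in grid a b n]).
    by exists n.
  by apply: ereal_sup_ubound; exists t.
pose u (j : nat) : R := 2 `^ (p * j%:R) * phi (2 ^- j).
have phi2 k : 0 <= phi (2 ^- k) by rewrite phi_ge0 // invr_ge0 exprn_ge0.
have u0 j : 0 <= u j by rewrite mulr_ge0 ?powR_ge0.
(* The terms being nonnegative, the finite sum of the series bounds every partial sum, however many
   scales a grid needs. *)
have [L L0 LP] : exists2 L : R, 0 <= L & forall m, \sum_(k < m) u k <= L.
  exists (fine (\sum_(0 <= j <oo) (u j)%:E)%E).
    by rewrite fine_ge0 // nneseries_ge0 // => j _ _; rewrite lee_fin.
  move=> m; rewrite -lee_fin fineK; last first.
    by rewrite ge0_fin_numE // nneseries_ge0 // => j _ _; rewrite lee_fin.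
  rewrite -sumEFin -(big_mkord xpredT (fun k => (u k)%:E)).
  by apply: nneseries_lim_ge => j _ _; rewrite lee_fin.
(* [C + 1] bounds every single jump: at threshold 1 the excess of one jump is at most [C]. *)
have [D [B [D0 B0 DBP]]] := @doubling_le_truncations R phi phi_gt0 phi_doubling (C + 1).
have max0 (y : R) : 0 <= Num.max y 0 by rewrite le_max lexx orbT.
suff bound n t : grid a b n t ->
    \sum_(i < n) phi `|f (t i.+1) - f (t i)| <=
      B * (C * 2 `^ p) + D * (C * 2 `^ p * L).
  apply: le_lt_trans (ltry (B * (C * 2 `^ p) + D * (C * 2 `^ p * L))).
  apply: ge_ereal_sup => _ [n _ <-]; apply: ge_ereal_sup => _ [t gt <-].
  by rewrite lee_fin; exact: bound.
move=> gt; pose x (i : 'I_n) := `|f (t i.+1) - f (t i)|.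
have x_le i : x i <= C + 1.
  have := trunc_le 1 n t ltr01 gt; rewrite powR1 mul1r (bigD1 i) //= => xC.
  have : x i - 1 <= Num.max (x i - 1) 0 by rewrite le_max lexx.
  have : 0 <= \sum_(j < n | j != i) Num.max (`|f (t j.+1) - f (t j)| - 1) 0.
    by apply: sumr_ge0.
  by rewrite /x; lra.
have scale_le k : 2 ^+ k.+1 * \sum_i Num.max (x i - 2 ^- k.+1) 0 <=
    C * 2 `^ p * 2 `^ (p * k%:R).
  by apply: truncation_powR; apply: trunc_le => //; rewrite invr_gt0 exprn_gt0.
pose g (y : R) k := phi (2 ^- k) * (2 ^+ k.+1 * Num.max (y - 2 ^- k.+1) 0).
have g0 y k : 0 <= g y k by rewrite /g mulr_ge0 // mulr_ge0 // exprn_ge0.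
have kP i : exists k, phi (x i) <= B * Num.max (x i - 2 ^- 1) 0 + D * g (x i) k.
  have [x0|x0] := ltrP 0 (x i); first exact: DBP.
  (* A zero jump has no dyadic scale; [phi 0 = 0] makes any [k] work. *)
  exists 0%N; rewrite (_ : x i = 0) ?phi0 ?addr_ge0 ?mulr_ge0 //.
  by apply/le_anti; rewrite x0 /x normr_ge0.
have [k {}kP] := choice kP.
(* The scale [k i] varies with the jump. Summing over all scales below a common [m] removes this
   dependence, so that the sums over jumps and scales can be exchanged; [m] disappears later through
   [L]. *)
pose m := (\max_i k i).+1.
have {}kP i : phi (x i) <=
    B * Num.max (x i - 2 ^- 1) 0 + D * \sum_(j < m) g (x i) j.
  apply: (le_trans (kP i)); rewrite lerD2l ler_wpM2l //.
  have im : (k i < m)%N by rewrite ltnS; exact: leq_bigmax.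
  by rewrite (bigD1 (Ordinal im)) //= lerDl sumr_ge0.
apply: (le_trans (ler_sum _ (fun i _ => kP i))).
rewrite big_split /= -!mulr_sumr exchange_big /=; apply: lerD.
  (* The large jumps are controlled by scale 0, whose threshold is 1/2; its factor [2 ^+ 1 >= 1] is
     dropped. *)
  apply: ler_wpM2l => //; have := scale_le 0%N.
  rewrite mulr0 powRr0 mulr1; apply: le_trans.
  by rewrite expr1 ler_peMl ?sumr_ge0 // ler1n.
apply: ler_wpM2l => //.
apply: (@le_trans _ _ (C * 2 `^ p * \sum_(j < m) u j)); last first.
  by apply: ler_wpM2l => //; rewrite mulr_ge0 // powR_ge0.
rewrite mulr_sumr; apply: ler_sum => j _.
rewrite -!mulr_sumr /u (mulrC (2 `^ (p * _))) [leRHS]mulrCA.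
exact: ler_wpM2l.
Qed.
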